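(* Let $n\ge1$, let $S_1\subseteq\langle a^2\rangle\setminus\{1\}$ and $S_2\subseteq\langle a^2\rangle a\cup\langle a^2\rangle ab\cup\langle a^2\rangle ab^2$ be such that $S=S_1\cup S_2\subseteq U_{6n}$ satisfies $1\notin S=S^{-1}$. Then $\mathrm{Cay}(U_{6n},S)$ is integral if and only if all of the following hold for $0\le j\le 2n-1$ and $0\le k\le n-1$: (1) $S_1\in B(\langle a^2\rangle)$; (2) $\chi_j(S_2)$ is an integer; (3) $2\psi_k(S_2^2)$ is a perfect square (the square of an integer).
   Context: For an integer $n\ge1$, $U_{6n}=\langle a,b\mid a^{2n}=b^3=1,\ a^{-1}ba=b^{-1}\rangle$, a group of order $6n$ whose elements are uniquely $a^ib^\epsilon$ with $0\le i\le 2n-1$, $\epsilon\in\{0,1,2\}$. Let $\omega=\exp(\pi\imath/n)$. Its irreducible complex characters are: the $2n$ linear characters $\chi_j$ ($0\le j\le 2n-1$) given by $\chi_j(a^{2r}b^\epsilon)=\omega^{2jr}$ and $\chi_j(a^{2r+1}b^\epsilon)=\omega^{j(2r+1)}$ for all $\epsilon\in\{0,1,2\}$; and the $n$ degree-two characters $\psi_k$ ($0\le k\le n-1$) given by $\psi_k(a^{2r})=2\omega^{2kr}$, $\psi_k(a^{2r}b)=\psi_k(a^{2r}b^2)=-\omega^{2kr}$, $\psi_k(a^{2r+1}b^\epsilon)=0$. For a character $\chi$ and a subset $A$, $\chi(A)=\sum_{x\in A}\chi(x)$ (with $\chi(\emptyset)=0$) and $\chi(A^2)=\sum_{x_1,x_2\in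 A}\chi(x_1x_2)$ over all ordered pairs. For a finite group $G$, the Boolean algebra $B(G)$ is the collection of subsets of $G$ obtainable from the subgroups of $G$ by finitely many unions, intersections and complements (in $G$). For a group $G$ and $S\subseteq G$ with $1\notin S=S^{-1}$, the Cayley graph $\mathrm{Cay}(G,S)$ has vertex set $G$ and edges $\{g,sg\}$ for $g\in G,s\in S$. A graph is integral if all eigenvalues of its adjacency matrix are integers. *)

(* Defs.v *)
From HB Require Import structures.
From mathcomp Require Import all_boot all_order all_algebra all_fingroup all_field.
Set Implicit Arguments. Unset Strict Implicit. Unset Printing Implicit Defensive.
Import GRing.Theory Num.Theory.

(* The group U_{6n}.  The element a^i b^e (0 <= i < 2n, e in {0,1,2}) *)
(* is represented by the pair (i, e) in 'Z_(2n) * 'Z_3.  From the     *)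
(* relation a^-1 b a = b^-1 we get b^e a^j = a^j b^(e (-1)^j), hence   *)
(*   (a^i b^e) (a^j b^f) = a^(i+j) b^((-1)^j e + f).                   *)
(* 'Z_(2n) is Z/2nZ as soon as n >= 1 (the theorem assumes 0 < n).    *)

Definition U6 (n : nat) : Type := ('Z_(n.*2) * 'Z_3)%type.

HB.instance Definition _ n := Finite.on (U6 n).

Local Open Scope ring_scope.

Definition U6sgn n (j : 'Z_(n.*2)) : 'Z_3 := if odd (val j) then -1 else 1.

Definition U6mul n (x y : U6 n) : U6 n :=
  (x.1 + y.1, U6sgn y.1 * x.2 + y.2).
Definition U6one n : U6 n := (0, 0).
Definition U6inv n (x : U6 n) : U6 n := (- x.1, - (U6sgn x.1 * x.2)).

Lemma U6mod_even n : odd (Zp_trunc n.*2).+2 = false.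
Proof. by case: n => [|n] //=; rewrite odd_double. Qed.

Lemma U6sgnD n (i j : 'Z_(n.*2)) : U6sgn (i + j) = U6sgn i * U6sgn j.
Proof.
rewrite /U6sgn /= odd_mod ?U6mod_even // oddD.
by case: (odd (val i)); case: (odd (val j)); rewrite ?mulr1 ?mul1r ?mulrNN ?mulr1.
Qed.

Lemma U6sgnN n (i : 'Z_(n.*2)) : U6sgn (- i) = U6sgn i.
Proof.
rewrite /U6sgn /= odd_mod ?U6mod_even // oddB ?U6mod_even //=.
by apply: ltnW; apply: ltn_ord.
Qed.

Lemma U6sgn2 n (i : 'Z_(n.*2)) : U6sgn i * U6sgn i = 1.
Proof. by rewrite /U6sgn; case: (odd _); rewrite ?mulrNN mulr1. Qed.

Lemma U6mulA n : associative (@U6mul n).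
Proof.
move=> [i e] [j f] [k g]; rewrite /U6mul /= addrA U6sgnD.
by congr (_, _); rewrite mulrDr addrA mulrA [U6sgn j * _]mulrC.
Qed.

Lemma U6mul1 n : left_id (@U6one n) (@U6mul n).
Proof. by move=> [i e]; rewrite /U6mul /= !add0r mulr0 add0r. Qed.

Lemma U6mulV n : left_inverse (@U6one n) (@U6inv n) (@U6mul n).
Proof.
move=> [i e]; rewrite /U6mul /U6inv /U6one /= addNr.
by rewrite mulrN mulrA U6sgn2 mul1r addNr.
Qed.

HB.instance Definition _ n :=
  Finite_isGroup.Build (U6 n) (@U6mulA n) (@U6mul1 n) (@U6mulV n).

Local Close Scope ring_scope.

Definition U6a n : U6 n := (1%R, 0%R).
Definition U6b n : U6 n := (0%R, 1%R).

Definition aexp n (x : U6 n) : nat := val x.1.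
Definition bexp n (x : U6 n) : nat := val x.2.

(* Characters.  omega = exp(pi i / n), realised in algC as n.-root(-1) *)
(* (the n-th root of -1 of minimal non-negative argument).            *)
Local Open Scope ring_scope.

Definition omega (n : nat) : algC := n.-root (-1).

Definition chi n (j : nat) (x : U6 n) : algC :=
  let i := aexp x in let r := i./2 in
  if odd i then omega n ^+ (j * (2 * r + 1))%N
  else omega n ^+ (2 * j * r)%N.

Definition psi n (k : nat) (x : U6 n) : algC :=
  let i := aexp x in let r := i./2 in
  if odd i then 0
  else if bexp x == 0%N then 2 * omega n ^+ (2 * k * r)%N
  else - omega n ^+ (2 * k * r)%N.

Definition cset n (f : U6 n -> algC) (A : {set U6 n}) : algC :=
  \sum_(x in A) f x.

Definition cset2 n (f : U6 n -> algC) (A : {set U6 n}) : algC :=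
  \sum_(x1 in A) \sum_(x2 in A) f (x1 * x2)%g.

Local Close Scope ring_scope.

Inductive in_boolalg (gT : finGroupType) (G : {set gT}) : {set gT} -> Prop :=
  | ba_subgroup (H : {group gT}) : H \subset G -> in_boolalg G H
  | ba_union A B : in_boolalg G A -> in_boolalg G B -> in_boolalg G (A :|: B)
  | ba_inter A B : in_boolalg G A -> in_boolalg G B -> in_boolalg G (A :&: B)
  | ba_compl A : in_boolalg G A -> in_boolalg G (G :\: A).

Local Open Scope ring_scope.

Definition cayley_adj (gT : finGroupType) (S : {set gT}) : 'M[algC]_#|gT| :=
  \matrix_(i, j) (((enum_val j * (enum_val i)^-1)%g \in S) : nat)%:R.

Definition integral_cayley (gT : finGroupType) (S : {set gT}) : Prop :=
  forall lambda : algC, eigenvalue (cayley_adj S) lambda -> lambda \is a Num.int.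

Local Close Scope ring_scope.

(* Main.v *)
(* Let w = exp(pi i / n).  For v = w^j and a cube root of unity z, the function
   a^p b^q |-> v^p z^q on U_{6n} is sent, under right translation by an element
   of S_1, to a multiple of itself, and under right translation by an element of
   S_2, to a multiple of the function attached to (v, z^-1).  Fourier analysis on
   the abelian group Z/2n x Z/3 therefore splits the adjacency operator into the
   scalars chi_j(S) (case z = 1) and into 2 x 2 blocks with diagonal entries
   s = chi_j(S_1) and off-diagonal entries X, Y with 2 X Y = psi_j(S_2^2), whose
   eigenvalues are s + t and s - t with t^2 = X Y.  If all of these are integers
   then 2 s, hence the algebraic integer s, is one as well.  Finally, all the
   chi_j(S_1) are integers exactly when S_1 is a union of sets of generators of
   cyclic subgroups of <a^2>: a Galois automorphism w |-> w^k fixes the integers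
   chi_j(S_1), and Fourier inversion turns this into stability of S_1 under
   x |-> x^k. *)

Require Import Defs.
From HB Require Import structures.
From mathcomp Require Import all_boot all_order all_algebra all_fingroup all_field.
From mathcomp Require Import cyclic ring.
Import Order.TTheory GRing.Theory Num.Theory.
Set Implicit Arguments. Unset Strict Implicit.
Local Open Scope ring_scope.

(** * [omega n] is a primitive root of unity *)

Lemma norm1_Re_ge1 (u : algC) : `|u| = 1 -> 1 <= 'Re u -> u = 1.
Proof.
move=> nu1 Reu; have := normC2_Re_Im u; rewrite nu1 expr1n => /esym e.
have Iu : 0 <= 'Im u ^+ 2 by rewrite real_exprn_even_ge0 ?Creal_Im.
have Ru : 'Re u ^+ 2 <= 1 by rewrite -e lerDl.
have Reu1 : 'Re u = 1.
  apply/eqP; rewrite eq_le Reu andbT.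
  by rewrite -[X in _ <= X](@expr1n _ 2) ler_pXn2r ?nnegrE ?(le_trans ler01) in Ru *.
move/(canRL (addKr _))/eqP: e; rewrite Reu1 expr1n addNr sqrf_eq0 => /eqP Iu0.
by rewrite [u]Crect Reu1 Iu0 mulr0 addr0.
Qed.

(* Writing [w = exp(i t)] with [0 < t] and [u = exp(i p)]: the first two
   hypotheses say [|p| <= t] once [cos p >= 0], the last two [2t <= |p|]
   unless [u = 1]. *)
Lemma unit_rotations_eq1 (w u : algC) :
    `|w| = 1 -> `|u| = 1 -> 0 < 'Im w ->
    'Re (u * w ^+ 2) <= 'Re u -> 'Re (u * (w ^+ 2)^*) <= 'Re u ->
    'Re (u * w) <= 'Re w -> 'Re (u * w^*) <= 'Re w ->
  u = 1.
Proof.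
move=> nw nu s_gt0.
have [cR sR xR yR] : [/\ 'Re w \is Num.real, 'Im w \is Num.real,
   'Re u \is Num.real & 'Im u \is Num.real] by rewrite !Creal_Re !Creal_Im.
have := normC2_Re_Im w; have := normC2_Re_Im u; rewrite nw nu expr1n.
rewrite !ReM !ImM !Re_conj !Im_conj [w ^+ 2]expr2 ReM ImM.
have := @norm1_Re_ge1 u nu; move: s_gt0 cR sR xR yR.
set c := 'Re w; set s := 'Im w; set x := 'Re u; set y := 'Im u.
move=> s_gt0 cR sR xR yR x_ge1 ey ew h1 h2 h3 h4.
have [/x_ge1//|x_lt1] := real_leP (real1 _) xR.
have es : s ^+ 2 = 1 - c ^+ 2 by rewrite ew; ring.
have exy : y ^+ 2 = 1 - x ^+ 2 by rewrite ey; ring.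
have s2_gt0 : 0 < 2 * s by rewrite mulr_gt0 ?ltr0Sn.
have xE : x = x * (c ^+ 2 + s ^+ 2) by rewrite -ew mulr1.
(* ['Re u - 'Re (u * w ^+ 2)] factors as [2 * s * (s * x + c * y)] because [c ^+ 2 + s ^+ 2 = 1];
   the positive factor cancels. *)
have a1 : 0 <= s * x + c * y.
  rewrite -(pmulr_rge0 _ s2_gt0); move: h1; rewrite -subr_ge0; congr (_ <= _).
  by rewrite [X in X - _]xE; ring.
have a2 : 0 <= s * x - c * y.
  rewrite -(pmulr_rge0 _ s2_gt0); move: h2; rewrite -subr_ge0; congr (_ <= _).
  by rewrite [X in X - _]xE; ring.
have b1 : 0 <= c * (1 - x) + s * y by rewrite -subr_ge0 in h3; move: h3; congr (_ <= _); ring.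
have b2 : 0 <= c * (1 - x) - s * y by rewrite -subr_ge0 in h4; move: h4; congr (_ <= _); ring.
have x1_gt0 : 0 < 1 - x by rewrite subr_gt0.
(* Multiplying paired inequalities removes the odd powers of [y]: the products are [x ^+ 2 - c ^+ 2]
   and [(1 - x) * (2 * c ^+ 2 - 1 - x)]. *)
have A : c ^+ 2 <= x ^+ 2.
  rewrite -subr_ge0; move: (mulr_ge0 a1 a2); congr (_ <= _).
  transitivity (s ^+ 2 * x ^+ 2 - c ^+ 2 * y ^+ 2); first by ring.
  by rewrite es exy; ring.
have B : x <= 2 * c ^+ 2 - 1.
  rewrite -subr_ge0 -(pmulr_rge0 _ x1_gt0); move: (mulr_ge0 b1 b2); congr (_ <= _).
  transitivity (c ^+ 2 * (1 - x) ^+ 2 - s ^+ 2 * y ^+ 2); first by ring.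
  by rewrite es exy; ring.
have x_ge0 : 0 <= x.
  rewrite -(pmulr_rge0 _ s2_gt0); move: (addr_ge0 a1 a2); congr (_ <= _); ring.
have c_ge0 : 0 <= c.
  have x2_gt0 : 0 < 2 * (1 - x) by rewrite mulr_gt0 ?ltr0Sn.
  rewrite -(pmulr_rge0 _ x2_gt0); move: (addr_ge0 b1 b2); congr (_ <= _); ring.
have cx : c <= x by rewrite -(@ler_pXn2r _ 2).
have := le_trans cx B; rewrite -subr_ge0.
have -> : 2 * c ^+ 2 - 1 - c = - ((1 - c) * (2 * c + 1)) by ring.
have p_gt0 : 0 < (1 - c) * (2 * c + 1).
  apply: mulr_gt0; first by rewrite subr_gt0 (le_lt_trans cx).
  by rewrite ltr_wpDl ?ltr01 // mulr_ge0 // ler0n.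
by rewrite oppr_ge0 => /(lt_le_trans p_gt0); rewrite ltxx.
Qed.

Lemma omega_expn n : (0 < n)%N -> omega n ^+ n = -1.
Proof. by move=> n_gt0; rewrite /omega rootCK. Qed.

Lemma omega_norm n : (0 < n)%N -> `|omega n| = 1.
Proof.
move=> n_gt0; apply/eqP; rewrite -(@pexpr_eq1 _ _ n) // -normrX omega_expn //.
by rewrite normrN1.
Qed.

(** [rootC_Re_max] only compares with roots in the closed upper half plane; the conjugate root, with
    the same real part, covers the rest. *)
Lemma Re_le_omega n u : (0 < n)%N -> u ^+ n = -1 -> 'Re u <= 'Re (omega n).
Proof.
move=> n_gt0 un; have [Iu|Iu] := real_leP (real0 _) (Creal_Im u).
  exact: rootC_Re_max.
rewrite -Re_conj; apply: rootC_Re_max => //; last by rewrite Im_conj oppr_ge0 ltW.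
by rewrite -rmorphXn /= un rmorphN1.
Qed.

(** A real [omega n] would be -1. For a primitive n-th root of unity [z], the root [- z] of -1 would
    then have real part at most -1, forcing [z = 1]. *)
Lemma Im_omega_gt0 n : (1 < n)%N -> 0 < 'Im (omega n).
Proof.
move=> n_gt1; have n_gt0 := ltnW n_gt1.
rewrite lt_neqAle Im_rootC_ge0 // andbT eq_sym; apply/eqP => I0.
have [z prim_z] := C_prim_root_exists n_gt0.
have nz : `|z| = 1.
  by apply/eqP; rewrite -(@pexpr_eq1 _ _ n) // -normrX prim_expr_order ?normr1.
have wE : omega n = 'Re (omega n) by rewrite {1}[omega n]Crect I0 mulr0 addr0.
have wR : omega n \is Num.real by rewrite wE Creal_Re.
have wN1 : omega n = -1.
  have /eqP := omega_norm n_gt0; rewrite real_eqr_norml // ler01 andbT.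
  case/orP=> /eqP // w1; have /eqP := omega_expn n_gt0.
  by rewrite w1 expr1n -addr_eq0 -mulr2n pnatr_eq0.
have := @Re_le_omega n (z * omega n) n_gt0.
rewrite exprMn prim_expr_order // mul1r omega_expn // => /(_ erefl).
rewrite wN1 mulrN1 !raddfN /= lerN2 (Creal_ReP _ _) ?real1 // => Rz.
have z1 := @norm1_Re_ge1 z nz Rz.
by have := prim_order_dvd prim_z 1; rewrite z1 expr1n eqxx dvdn1 gtn_eqF.
Qed.

(* In each coset of [<omega ^ 2>] among the n-th roots of unity, the element of
   maximal real part has to be 1. *)
Lemma omega_sqr_generates n z : (1 < n)%N -> z ^+ n = 1 ->
  exists m, z * omega n ^+ m.*2 = 1.
Proof.
move=> n_gt1 zn; have n_gt0 := ltnW n_gt1; set w := omega n.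
have wn : w ^+ n = -1 by apply: omega_expn.
have w2n : (w ^+ 2) ^+ n = 1 by rewrite exprAC wn sqrrN expr1n.
have w_neq0 : w != 0 by rewrite -normr_gt0 omega_norm.
have wV : w^* = w^-1 by rewrite invC_norm omega_norm // expr1n invr1 mul1r.
pose F (i : 'I_n) := 'Re (z * (w ^+ 2) ^+ i).
have [|i _ i_max] := @real_arg_maxP _ _ (Ordinal n_gt0) predT F isT.
  by move=> i _; apply: Creal_Re.
have F_max k : 'Re (z * (w ^+ 2) ^+ k) <= F i.
  by rewrite -(expr_mod k w2n); apply: (i_max (Ordinal (ltn_pmod k n_gt0))).
set u := z * (w ^+ 2) ^+ i; exists (i : nat).
rewrite -muln2 mulnC exprM -/u.
have un : u ^+ n = 1 by rewrite exprMn zn mul1r -(exprM (w ^+ 2)) mulnC exprM w2n expr1n.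
apply: (@unit_rotations_eq1 w).
- exact: omega_norm.
- by apply/eqP; rewrite -(@pexpr_eq1 _ _ n) // -normrX un normr1.
- exact: Im_omega_gt0.
- by rewrite -mulrA -exprSr F_max.
(* The conjugate of [w ^+ 2] is its inverse, hence its power [n.-1], so maximality covers this
   neighbour too. *)
- have -> : u * (w ^+ 2)^* = z * (w ^+ 2) ^+ (i + n.-1).
    rewrite exprD mulrA -/u; congr (_ * _).
    apply: (mulIf (expf_neq0 2 w_neq0)); rewrite -[in RHS]exprSr prednK //. rewrite w2n.
    by rewrite rmorphXn /= wV -exprMn mulVf // expr1n.
  exact: F_max.
- by apply: Re_le_omega; rewrite // exprMn un wn mul1r.
- apply: Re_le_omega; rewrite // exprMn un mul1r.
  by rewrite -rmorphXn /= wn rmorphN1.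
Qed.

(** An odd order [d] would divide [n], against [omega n ^+ n = -1]. For even [d], raising
    [z * w ^+ m.*2 = 1] to the power [d./2], with [z] a primitive n-th root of unity, gives
    [n %| d./2]. *)
Lemma omega_prim n : (0 < n)%N -> n.*2.-primitive_root (omega n).
Proof.
move=> n_gt0; set w := omega n.
have wn : w ^+ n = -1 by apply: omega_expn.
have N1 : (-1 : algC) != 1.
  by rewrite eq_sym -addr_eq0 -mulr2n pnatr_eq0.
have w2n : w ^+ n.*2 = 1 by rewrite -muln2 exprM wn sqrrN expr1n.
have [|d prim_w d_dv] := @prim_order_exists _ n.*2 w _ w2n; first by rewrite double_gt0.
suff n_dv : (n.*2 %| d)%N by have /eqP <- : d == n.*2 by rewrite eqn_dvd d_dv.
have d_even : ~~ odd d.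
  apply: contra N1 => d_odd; rewrite -wn -(prim_order_dvd prim_w).
  by rewrite -(@Gauss_dvdr _ 2) ?coprimen2 // mul2n.
rewrite -(even_halfK d_even) -!mul2n dvdn_pmul2l //.
have [n_gt1|] := ltnP 1 n; last by case: (n) n_gt0 => // [[]] // _ _; rewrite dvd1n.
have [z prim_z] := C_prim_root_exists n_gt0.
have [m zw] := omega_sqr_generates n_gt1 (prim_expr_order prim_z).
rewrite (prim_order_dvd prim_z).
have := congr1 (fun t => t ^+ d./2) zw; rewrite exprMn -exprM -muln2 -mulnA mul2n.
by rewrite even_halfK // mulnC exprM (prim_expr_order prim_w) !expr1n mulr1 => ->.
Qed.

(** * Character sums over Boolean algebras of subgroups *)

Lemma sum_expr_unity (c : algC) m : c ^+ m = 1 ->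
  \sum_(j < m) c ^+ j = if c == 1 then m%:R else 0.
Proof.
move=> cm; have [->|c_neq1] := eqVneq.
  under eq_bigr do rewrite expr1n.
  by rewrite sumr_const card_ord.
have /eqP := subrX1 c m; rewrite cm subrr eq_sym mulf_eq0 subr_eq0.
by rewrite (negPf c_neq1) => /eqP.
Qed.

(** Summing over [j] first leaves geometric sums in the root of unity [c y / c x], which vanish
    unless [c y = c x]. *)
Lemma fourier_inversion (T : finType) (A : {pred T}) (a c : T -> algC) m x :
    (forall y, c y ^+ m = 1) -> (forall y, y \in A -> (c y == c x) = (y == x)) ->
  \sum_(j < m) (\sum_(y in A) a y * c y ^+ j) * (c x)^-1 ^+ j
    = if x \in A then m%:R * a x else 0.
Proof.
move=> cm c_inj; have [->|m_gt0] := posnP m.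
  by rewrite big_ord0 mul0r if_same.
have cx_neq0 : c x != 0.
  have /eqP := cm x; apply: contraTneq => ->.
  by rewrite expr0n gtn_eqF // eq_sym oner_eq0.
under eq_bigr do rewrite mulr_suml.
rewrite exchange_big /=.
transitivity (\sum_(y in A | y == x) m%:R * a y).
  rewrite [RHS]big_mkcondr; apply: eq_bigr => y Ay.
  under eq_bigr do rewrite -mulrA -exprMn.
  rewrite -mulr_sumr sum_expr_unity; last by rewrite exprMn exprVn !cm invr1 mulr1.
  rewrite -(inj_eq (mulIf cx_neq0)) divfK // mul1r c_inj //.
  by case: eqP; rewrite ?mulr0 // mulrC.
have [Ax|nAx] := boolP (x \in A).
  by rewrite (big_pred1 x) // => y /=; rewrite andbC; case: eqP => // ->.
by rewrite big1 // => y /andP[Ay /eqP yx]; rewrite -yx Ay in nAx.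
Qed.

(** If [l h != 1] for some [h] in [H], translation by [h] forces the sum to be 0; otherwise the sum
    is the order of [H]. *)
Lemma sum_group_int (gT : finGroupType) (H : {group gT}) (l : gT -> algC) :
    {in H &, forall x y, l (x * y)%g = l x * l y} ->
  \sum_(x in H) l x \is a Num.int.
Proof.
move=> lM; have [h /andP[Hh lh]|all1] := pickP [pred x in H | l x != 1].
  suff -> : \sum_(x in H) l x = 0 by rewrite rpred0.
  apply/eqP; have : (l h - 1) * \sum_(x in H) l x == 0.
    rewrite mulrBl mul1r subr_eq0 mulr_sumr; apply/eqP.
    rewrite [RHS](reindex_inj (mulgI h)) /=; apply: eq_big => x.
      by rewrite groupMl.
    by move=> Hx; rewrite lM.
  by rewrite mulf_eq0 subr_eq0 (negPf lh).
rewrite (eq_bigr (fun=> 1)) ?sumr_const ?rpredMn ?rpred1 // => x Hx.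
by have := all1 x; rewrite /= Hx /= => /negbFE/eqP.
Qed.

Lemma sum_setD_int (T : finType) (l : T -> algC) (A B : {set T}) :
    \sum_(x in B) l x \is a Num.int -> \sum_(x in A :&: B) l x \is a Num.int ->
  \sum_(x in B :\: A) l x \is a Num.int.
Proof.
move=> sB sAB; rewrite [X in X \is a _](_ : _ = \sum_(x in B) l x - \sum_(x in A :&: B) l x) ?rpredB //.
by rewrite [in RHS](big_setID A) /= setIC addrC addrK.
Qed.

(* Quantifying over [B] makes the property stable under intersections. *)
Lemma boolalg_sum_setI_int (gT : finGroupType) (G : {group gT}) (l : gT -> algC) A :
    {in G &, forall x y, l (x * y)%g = l x * l y} -> in_boolalg G A ->
  forall B : {set gT},
    (forall H : {group gT}, H \subset G -> \sum_(x in B :&: H) l x \is a Num.int) ->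
  forall H : {group gT}, H \subset G -> \sum_(x in A :&: (B :&: H)) l x \is a Num.int.
Proof.
move=> lM; elim=> {A} [K sKG|A A' _ IH _ IH'|A A' _ IH _ IH'|A _ IH] B sB H sHG.
- rewrite setICA; apply: sB; exact: subset_trans (subsetIr _ _) sHG.
- rewrite (big_setID A) /= rpredD //.
    by rewrite setIC setIA setUC setKU IH.
  rewrite (_ : (A :|: A') :&: (B :&: H) :\: A = (A' :&: (B :&: H)) :\: A); last first.
    by apply/setP=> x; rewrite !inE; case: (x \in A); rewrite ?andbF.
  apply: sum_setD_int; first exact: IH'.
  rewrite [A' :&: _]setIA; apply: IH => // K sKG.
  by rewrite -setIA; apply: IH'.
- rewrite -setIA [A' :&: _]setIA; apply: IH => // K sKG.
  by rewrite -setIA; apply: IH'.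
- rewrite (_ : (G :\: A) :&: (B :&: H) = (B :&: H) :\: A); last first.
    apply/setP=> x; rewrite !inE; case: (boolP (x \in H)) => [/(subsetP sHG)->|];
    by rewrite ?andbT ?andbF.
  by apply: sum_setD_int; [apply: sB|apply: IH].
Qed.

Lemma boolalg_sum_int (gT : finGroupType) (G : {group gT}) (l : gT -> algC) A :
    {in G &, forall x y, l (x * y)%g = l x * l y} -> in_boolalg G A ->
    A \subset G ->
  \sum_(x in A) l x \is a Num.int.
Proof.
move=> lM bA sAG; have -> : A = A :&: (G :&: G) by rewrite setIid (setIidPl sAG).
apply: boolalg_sum_setI_int bA _ _ _ _ => // H sHG.
rewrite (setIidPr sHG); apply: sum_group_int.
by move=> x y Hx Hy; rewrite lM ?(subsetP sHG).
Qed.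

Lemma boolalg_bigcup (gT : finGroupType) (G : {group gT}) (I : finType) (P : pred I)
    (F : I -> {set gT}) :
  (forall i, P i -> in_boolalg G (F i)) -> in_boolalg G (\bigcup_(i | P i) F i).
Proof.
move=> bF; elim/big_ind: _ => //; last exact: ba_union.
by rewrite -(setDv G); apply/ba_compl/ba_subgroup.
Qed.

(** The generators of [<[x]>] are what remains after removing its proper cyclic subgroups. *)
Lemma boolalg_generators (gT : finGroupType) (G : {group gT}) x :
  x \in G -> in_boolalg G [set y | <[y]> == <[x]>]%g.
Proof.
move=> Gx; have sxG y : (y \in <[x]> -> <[y]> \subset G)%g.
  by rewrite -cycle_subG => /subset_trans-> //; rewrite cycle_subG.
pose U := (\bigcup_(y in <[x]> | <[y]> != <[x]>) <[y]>)%g.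
rewrite (_ : [set _ | _] = <[x]>%g :&: (G :\: U)).
  apply: ba_inter; first by apply/ba_subgroup/sxG/cycle_id.
  apply/ba_compl/boolalg_bigcup => y /andP[xy _].
  exact/ba_subgroup/sxG.
apply/setP => y; rewrite !inE; apply/eqP/and3P => [yx|[xy yU _]].
  have xy : (y \in <[x]>)%g by rewrite -yx cycle_id.
  split=> //; last by rewrite (subsetP (sxG _ xy)) ?cycle_id.
  apply/bigcupP => -[t /andP[xt /negP tx]]; rewrite -cycle_subG yx => xst; apply: tx.
  by rewrite eqEsubset xst cycle_subG xt.
apply/eqP; apply: contraNT yU => yx; apply/bigcupP.
by exists y; rewrite ?xy ?cycle_id.
Qed.

Lemma boolalg_of_generator_closed (gT : finGroupType) (G : {group gT}) (A : {set gT}) :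
    A \subset G -> (forall x y, x \in A -> <[x]> = <[y]> -> y \in A)%g ->
  in_boolalg G A.
Proof.
move=> sAG clA; rewrite (_ : A = \bigcup_(x in A) [set y | <[y]> == <[x]>]%g).
  by apply: boolalg_bigcup => x Ax; apply/boolalg_generators/(subsetP sAG).
apply/setP=> y; apply/idP/bigcupP => [Ay|[x Ax]]; first by exists y; rewrite ?inE.
by rewrite inE => /eqP/esym; apply: clA.
Qed.

(** * Integrality of character sums on a cyclic group *)

Section CyclicGroup.
Variables (gT : finGroupType) (g : gT) (z : algC) (l : gT -> algC).
Hypotheses (z_prim : #[g]%g.-primitive_root z)
  (lE : forall i, l (g ^+ i)%g = z ^+ i).

Lemma cycle_fourier_inversion (A : {set gT}) x :
    A \subset <[g]>%g -> x \in <[g]>%g ->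
  \sum_(j < #[g]%g) (\sum_(y in A) l y ^+ j) * (l x)^-1 ^+ j = (#[g]%g * (x \in A))%:R.
Proof.
move=> sA gx.
(* Nothing is known of [l] outside [<[g]>]; the default 1 makes every [c y] a root of unity. *)
pose c y := if y \in <[g]>%g then l y else 1.
have cm y : c y ^+ #[g]%g = 1.
  rewrite /c; case: ifP => [/cycleP[i ->]|]; last by rewrite expr1n.
  by rewrite lE -exprM mulnC exprM (prim_expr_order z_prim) expr1n.
have c_inj y : y \in A -> (c y == c x) = (y == x).
  move=> /(subsetP sA) gy; rewrite /c gx gy.
  case/cycleP: gx => i ->; case/cycleP: gy => k ->.
  by rewrite !lE eq_expg_mod_order (eq_prim_root_expr z_prim).
rewrite natrM mulr_natr mulrb.
have := @fourier_inversion _ (mem A) (fun=> 1) c _ x cm c_inj.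
rewrite mulr1 => <-; apply: eq_bigr => j _; rewrite /c gx; congr (_ * _).
by apply: eq_bigr => y /(subsetP sA) ->; rewrite mul1r.
Qed.

(** Fourier inversion recovers the indicator of [A] from the sums. For [y = x ^+ k] generating
    [<[x]>], the automorphism [u] fixes the integer sums and sends [l x] to [l y], so the indicator
    agrees at [x] and [y]. *)
Lemma boolalg_cycle_of_sum_int (A : {set gT}) :
    A \subset <[g]>%g -> (forall j : nat, \sum_(x in A) l x ^+ j \is a Num.int) ->
  in_boolalg <[g]>%g A.
Proof.
move=> sA sAint; apply: boolalg_of_generator_closed => // x y Ax xy.
have gx := subsetP sA x Ax.
have [k yE] : exists k, y = (x ^+ k)%g by apply/cycleP; rewrite xy cycle_id.
have gy : y \in <[g]>%g by rewrite yE groupX.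
have k_co : coprime k #[x]%g.
  by rewrite coprime_sym -generator_coprime -yE /generator xy.
have [u uE] := Qn_aut_exists k_co.
have lxX i : l (x ^+ i)%g = l x ^+ i.
  by case/cycleP: gx => k' ->; rewrite -expgM !lE exprM.
have l1 : l 1%g = 1 by rewrite -(expg0 g) lE.
suff /eqP : (#[g]%g * (y \in A))%:R = (#[g]%g * (x \in A))%:R :> algC.
  by rewrite Ax eqr_nat eqn_pmul2l ?order_gt0 // eqb1.
rewrite -(rmorph_nat u (_ * (x \in A))) -!cycle_fourier_inversion // rmorph_sum /=.
apply: eq_bigr => j _; rewrite rmorphM /=; congr (_ * _).
  by have /intrP[m ->] := sAint j; rewrite rmorph_int.
rewrite uE; first by rewrite yE lxX -exprVn exprAC.
by rewrite exprAC exprVn -lxX expg_order l1 invr1 expr1n.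
Qed.
End CyclicGroup.

(** * Spectrum of the Cayley graph *)

Lemma fourier_injective (T : finType) (a c : T -> algC) m :
    (0 < m)%N -> (forall y, c y ^+ m = 1) -> injective c ->
    (forall j : 'I_m, \sum_y a y * c y ^+ j = 0) ->
  forall x, a x = 0.
Proof.
move=> m_gt0 cm c_inj a0 x.
have := @fourier_inversion _ predT a c m x cm (fun y _ => inj_eq c_inj y x).
rewrite big1 => [/esym/eqP|j _]; last by rewrite a0 mul0r.
by rewrite mulf_eq0 pnatr_eq0 gtn_eqF //= => /eqP.
Qed.

(** Reading a row vector at inverses of vertices turns left multiplication into right translation:
    [s = j * i^-1] means [i^-1 = j^-1 * s]. *)
Lemma eigenvalue_cayleyP (gT : finGroupType) (S : {set gT}) lambda :
  eigenvalue (cayley_adj S) lambda <->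
  exists2 f : gT -> algC, exists g, f g != 0
    & forall g, \sum_(s in S) f (g * s)%g = lambda * f g.
Proof.
have sumE (f : gT -> algC) j :
    \sum_(i < #|gT|) f (enum_val i)^-1%g * cayley_adj S i j
    = \sum_(s in S) f ((enum_val j)^-1 * s)%g.
  rewrite [RHS]big_mkcond [RHS](@reindex _ _ _ _ 'I_#|gT| (fun i => enum_val j * (enum_val i)^-1)%g) /=.
    apply: eq_bigr => i _; rewrite !mxE mulKg.
    by case: ifP => _; rewrite ?mulr1 ?mulr0.
  exists (fun s => enum_rank (s^-1 * enum_val j)%g) => [i|s] _.
    by rewrite invMg invgK mulgKV enum_valK.
  by rewrite enum_rankK invMg invgK mulKVg.
split=> [/eigenvalueP[v vA v_neq0]|[f [g fg_neq0] fE]].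
  exists (fun g => v 0 (enum_rank g^-1%g)).
    have /rV0Pn[i vi] := v_neq0; exists (enum_val i)^-1%g.
    by rewrite invgK enum_valK.
  move=> g; have /rowP/(_ (enum_rank g^-1%g)) := vA; rewrite !mxE => <-.
  have := sumE (fun g => v 0 (enum_rank g^-1%g)) (enum_rank g^-1%g).
  rewrite enum_rankK invgK => <-.
  by apply: eq_bigr => i _; rewrite invgK enum_valK.
apply/eigenvalueP; exists (\row_i f (enum_val i)^-1%g).
  apply/rowP=> j; rewrite !mxE -fE -sumE.
  by apply: eq_bigr => i _; rewrite !mxE.
apply/rV0Pn; exists (enum_rank g^-1%g).
by rewrite mxE enum_rankK invgK.
Qed.

Lemma expr_ordD p (v : algC) (i j : 'I_p.+1) : v ^+ p.+1 = 1 ->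
  v ^+ (i + j)%R = v ^+ i * v ^+ j.
Proof. by move=> vp; rewrite -exprD -(expr_mod (i + j) vp). Qed.

Lemma expr_ordN p (v : algC) (i : 'I_p.+1) : v ^+ p.+1 = 1 ->
  v ^+ (- i)%R = v^-1 ^+ i.
Proof.
move=> vp; have v_neq0 : v != 0.
  by have /eqP := vp; apply: contraTneq => ->; rewrite expr0n eq_sym oner_eq0.
apply: (mulIf (expf_neq0 i v_neq0)).
by rewrite -expr_ordD // addNr expr0 -exprMn mulVf // expr1n.
Qed.

Lemma sum_cube_root (y : algC) : y ^+ 3 = 1 -> y != 1 -> 1 + y + y ^+ 2 = 0.
Proof.
move=> y3 y_neq1; have := @sum_expr_unity y 3 y3; rewrite (negPf y_neq1).
by rewrite !big_ord_recl big_ord0 /= expr0 expr1 addr0 addrA.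
Qed.

Lemma Aint_sum_unity (T : finType) (A : {set T}) (c : T -> algC) m :
  (0 < m)%N -> (forall x, c x ^+ m = 1) -> \sum_(x in A) c x \in Aint.
Proof.
move=> m_gt0 cm; apply: rpred_sum => x _.
by apply: (Aint_unity_root m_gt0); apply/unity_rootP.
Qed.

(** The square is rational and an algebraic integer, hence an integer, so [y] is a root of a monic
    integer polynomial. *)
Lemma int_of_rat_sqr (y : algC) : y \in Crat -> y ^+ 2 \in Aint -> y \is a Num.int.
Proof.
move=> y_rat y2_int; apply: Cint_rat_Aint => //.
have y2 : y ^+ 2 \is a Num.int by apply: Cint_rat_Aint => //; rewrite rpredX.
apply: (@root_monic_Aint ('X^2 - (y ^+ 2)%:P)).
- by rewrite rootE !hornerE subrr.
- by rewrite monicXnsubC.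
- by apply/polyOverP => i; rewrite coefB coefXn coefC rpredB ?rpred_nat //; case: ifP => _; rewrite ?y2 ?rpred0.
Qed.

(** * Fourier analysis on U_{6n} *)

Section U6n.
Variable n : nat.
Hypothesis n_gt0 : (0 < n)%N.
Let N := (Zp_trunc n.*2).+2.
Implicit Types (x y g s : U6 n) (v z : algC).

Lemma U6_modulus : N = n.*2.
Proof. by rewrite /N Zp_cast // -mul2n -[2%N]muln1 leq_pmul2l. Qed.

Lemma omega_unity k : (omega n ^+ k) ^+ N = 1.
Proof.
by rewrite exprAC U6_modulus (prim_expr_order (omega_prim n_gt0)) expr1n.
Qed.

Lemma odd_ZpD (i j : 'Z_(n.*2)) : odd (i + j)%R = odd i (+) odd j.
Proof. by rewrite /= odd_mod ?U6mod_even // oddD. Qed.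

Lemma U6fstM x y : (x * y)%g.1 = x.1 + y.1.
Proof. by []. Qed.

Lemma U6sndM x y : (x * y)%g.2 = U6sgn y.1 * x.2 + y.2.
Proof. by []. Qed.

(** For [v ^+ N = 1] and [z ^+ 3 = 1] this is a character of the abelian group Z/2n x Z/3. *)
Definition U6char v z x : algC := v ^+ (val x.1) * z ^+ (val x.2).

(** Moving a power of b past an odd power of a inverts it, which replaces [z] by [z^-1]. *)
Lemma U6charM v z x y : v ^+ N = 1 -> z ^+ 3 = 1 ->
  U6char v z (x * y)%g =
  U6char v z y * U6char v (if odd (val y.1) then z^-1 else z) x.
Proof.
move=> vN z3; rewrite /U6char U6fstM U6sndM !expr_ordD //.
rewrite mulrACA mulrC; congr (_ * (_ * _)); rewrite /U6sgn.
by case: ifP => _; rewrite ?mul1r // mulN1r expr_ordN.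
Qed.

Lemma U6char_unity v z x : v ^+ N = 1 -> z ^+ 3 = 1 -> U6char v z x ^+ (N * 3) = 1.
Proof.
move=> vN z3; rewrite /U6char exprMn (exprAC v) exprM vN !expr1n mul1r.
by rewrite (exprAC z) mulnC exprM z3 !expr1n.
Qed.

Lemma chiE j x : chi j x = U6char (omega n ^+ j) 1 x.
Proof.
rewrite /chi /U6char expr1n mulr1 -exprM; set i := aexp x.
rewrite -[val x.1]/i -[in RHS](odd_double_half i) -mul2n.
by case: (odd i) => /=; rewrite ?add0n ?(addnC 1%N) // mulnCA mulnA.
Qed.

(** Since [1 + z + z ^+ 2 = 0], the sum of [z ^+ e] and its inverse is 2 for [e = 0] and -1 for
    [e = 1, 2]. *)
Lemma psiE k x z : z ^+ 3 = 1 -> z != 1 -> ~~ odd (val x.1) ->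
  psi k x = U6char (omega n ^+ k) z x + U6char (omega n ^+ k) z^-1 x.
Proof.
move=> z3 z_neq1 x_even; rewrite /psi /U6char /bexp.
rewrite -[aexp x]/(val x.1) (negPf x_even) -mulrDr -exprM.
have -> : (k * val x.1 = 2 * k * (val x.1)./2)%N.
  by rewrite -{1}(even_halfK x_even) -mul2n; ring.
have z0 := sum_cube_root z3 z_neq1.
have zV : z^-1 = z ^+ 2.
  have z_neq0 : z != 0.
    by have /eqP := z3; apply: contraTneq => ->; rewrite expr0n eq_sym oner_eq0.
  by apply: (mulIf z_neq0); rewrite mulVf // -exprSr z3.
have zz : z + z ^+ 2 = -1 by apply/eqP; rewrite -subr_eq0 opprK addrC addrA z0.
rewrite zV; case: x.2 => -[|[|[|//]]] /= _; first by rewrite mulrC.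
  by rewrite expr1 zz mulrN1.
by rewrite -exprM (exprSr z 3) z3 mul1r addrC zz mulrN1.
Qed.

(** Bridges the range [j < 2n] of the Fourier index and the range [k < n] of condition (3). *)
Lemma psi_mod k x : psi (k %% n) x = psi k x.
Proof.
have w2n : (omega n ^+ 2) ^+ n = 1.
  by rewrite -exprM mul2n prim_expr_order // omega_prim.
have e r : omega n ^+ (2 * (k %% n) * r) = omega n ^+ (2 * k * r).
  by rewrite !exprM expr_mod.
by rewrite /psi !e.
Qed.

Section CayleySet.
Variables S1 S2 : {set U6 n}.
Hypotheses (S1_even : forall s, s \in S1 -> ~~ odd (val s.1) /\ s.2 = 0)
  (S2_odd : forall s, s \in S2 -> odd (val s.1)).

Definition even_sum v : algC := \sum_(s in S1) v ^+ (val s.1).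
Definition odd_sum v z : algC := \sum_(s in S2) U6char v z s.

Lemma sum_U6char v z g : v ^+ N = 1 -> z ^+ 3 = 1 ->
  \sum_(s in S1 :|: S2) U6char v z (g * s)%g =
  even_sum v * U6char v z g + odd_sum v z * U6char v z^-1 g.
Proof.
move=> vN z3; have S12 : [disjoint S1 & S2].
  apply/pred0P => s /=; apply/andP => -[/S1_even[s_even _] /S2_odd].
  exact/negP.
rewrite (eq_bigl [predU S1 & S2]) => [|s]; last by rewrite !inE.
rewrite bigU //= /even_sum /odd_sum !mulr_suml; congr (_ + _); apply: eq_bigr => s Ss.
  have [s_even s20] := S1_even Ss.
  by rewrite U6charM // (negPf s_even) {1}/U6char s20 expr0 mulr1.
by rewrite U6charM // S2_odd.
Qed.

(** Products of two elements of [S2] have even a-exponent, so [psiE] splits each term in two; both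
    double sums factor into the same product. *)
Lemma cset2_psi k z : z ^+ 3 = 1 -> z != 1 -> 
  cset2 (psi k) S2 = 2 * (odd_sum (omega n ^+ k) z * odd_sum (omega n ^+ k) z^-1).
Proof.
move=> z3 z_neq1; rewrite /cset2; set v := omega n ^+ k.
have vN : v ^+ N = 1 by apply: omega_unity.
rewrite (eq_bigr (fun x => odd_sum v z * U6char v z^-1 x + odd_sum v z^-1 * U6char v z x)).
  by rewrite big_split -!mulr_sumr /= -/(odd_sum v z) -/(odd_sum v z^-1); ring.
move=> x S2x; rewrite !mulr_suml -big_split; apply: eq_bigr => y S2y.
have zV3 : z^-1 ^+ 3 = 1 by rewrite exprVn z3 invr1.
rewrite (psiE _ z3) //; last by rewrite U6fstM odd_ZpD !S2_odd.
by rewrite !U6charM // S2_odd // invrK.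
Qed.

Lemma eigenvalue_linear v : v ^+ N = 1 ->
  eigenvalue (cayley_adj (S1 :|: S2)) (even_sum v + odd_sum v 1).
Proof.
move=> vN; apply/eigenvalue_cayleyP; exists (U6char v 1).
  by exists 1%g; rewrite /U6char !expr0 mulr1 oner_eq0.
by move=> g; rewrite sum_U6char ?expr1n // invr1 mulrDl.
Qed.

Lemma eigenvalue_quadratic v z t : v ^+ N = 1 -> z ^+ 3 = 1 -> z != 1 ->
    t ^+ 2 = odd_sum v z * odd_sum v z^-1 ->
  eigenvalue (cayley_adj (S1 :|: S2)) (even_sum v + t).
Proof.
move=> vN z3 z_neq1 t2; apply/eigenvalue_cayleyP.
have zV3 : z^-1 ^+ 3 = 1 by rewrite exprVn z3 invr1.
have z_neq0 : z != 0.
  by have /eqP := z3; apply: contraTneq => ->; rewrite expr0n eq_sym oner_eq0.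
have zVz : z - z^-1 != 0.
  rewrite subr_eq0 -(inj_eq (mulIf z_neq0)) mulVf // -expr2.
  by apply: contra z_neq1 => /eqP z2; rewrite -z3 exprSr z2 mul1r.
(* [(a, b)] is an eigenvector of the off-diagonal part of the block for [t]. If [odd_sum v z^-1]
   vanishes, then [t = 0] and [(0, 1)] serves. *)
have [a [b [ab_neq0 ea eb]]] : exists a, exists b,
  [/\ (a != 0) || (b != 0), b * odd_sum v z^-1 = t * a & a * odd_sum v z = t * b].
  have [B0|B_neq0] := eqVneq (odd_sum v z^-1) 0.
    exists 0, 1; rewrite oner_eq0 orbT B0 !mulr0 mul0r mulr1; split=> //.
    by apply/esym/eqP; rewrite -sqrf_eq0 t2 B0 mulr0.
  by exists (odd_sum v z^-1), t; rewrite B_neq0; split=> //; rewrite mulrC -t2 expr2.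
exists (fun g => a * U6char v z g + b * U6char v z^-1 g).
  (* The values at 1 and b cannot both vanish: their determinant in [a] and [b] is [z^-1 - z]. *)
  suff /orP[h|h] : (a + b != 0) || (a * z + b * z^-1 != 0).
  - by exists 1%g; rewrite /U6char !expr0 !mulr1.
  - by exists (0, 1); rewrite /U6char !expr0 !mul1r.
  rewrite -negb_and; apply: contraTN ab_neq0 => /andP[].
  rewrite addrC addr_eq0 => /eqP ->; rewrite mulNr -mulrBr mulf_eq0 (negPf zVz) orbF.
  by move=> /eqP ->; rewrite oppr0 eqxx.
move=> g; rewrite big_split -!mulr_sumr /= !sum_U6char // invrK.
transitivity (even_sum v * (a * U6char v z g + b * U6char v z^-1 g)
  + (b * odd_sum v z^-1 * U6char v z g + a * odd_sum v z * U6char v z^-1 g)); first by ring.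
by rewrite ea eb; ring.
Qed.

Hypothesis SV : ((S1 :|: S2)^-1 = S1 :|: S2)%g.

(** As [S1 :|: S2] is closed under inverses, the sum of its right translations is self-transpose and
    can be moved from [f] onto [U6char v z]. *)
Lemma cayley_fourier f lambda v z : v ^+ N = 1 -> z ^+ 3 = 1 ->
    (forall g, \sum_(s in S1 :|: S2) f (g * s)%g = lambda * f g) ->
  lambda * \sum_g f g * U6char v z g =
  even_sum v * (\sum_g f g * U6char v z g) + odd_sum v z * (\sum_g f g * U6char v z^-1 g).
Proof.
move=> vN z3 fE; rewrite mulr_sumr.
under eq_bigr do rewrite mulrA -fE mulr_suml.
rewrite exchange_big /=.
transitivity (\sum_(s in S1 :|: S2) \sum_g f g * U6char v z (g * s)%g).
  rewrite [RHS](reindex_inj invg_inj) /=; apply: eq_big => s.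
    by rewrite -{1}SV mem_invg.
  by move=> _; rewrite [RHS](reindex_inj (mulIg s)); under [RHS]eq_bigr do rewrite mulgK.
rewrite exchange_big /= !mulr_sumr -big_split; apply: eq_bigr => g _ /=.
by rewrite -mulr_sumr sum_U6char //; ring.
Qed.

Lemma eigenvalue_cases lambda :
    eigenvalue (cayley_adj (S1 :|: S2)) lambda ->
  exists2 j : nat, (j < n.*2)%N &
    lambda = even_sum (omega n ^+ j) + odd_sum (omega n ^+ j) 1 \/
    exists z, [/\ z ^+ 3 = 1, z != 1 & (lambda - even_sum (omega n ^+ j)) ^+ 2 =
      odd_sum (omega n ^+ j) z * odd_sum (omega n ^+ j) z^-1].
Proof.
move=> /eigenvalue_cayleyP[f [g fg_neq0] fE].
have [z z_prim] := @C_prim_root_exists 3 isT.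
have w_prim := omega_prim n_gt0; have wN := prim_expr_order w_prim.
set w := omega n in w_prim wN *.
pose F v (y : algC) := \sum_g f g * U6char v y g.
have [[j t] /= F_neq0|F0] := pickP (fun p : 'I_N * 'I_3 => F (w ^+ p.1) (z ^+ p.2) != 0).
  exists (j : nat); first by rewrite -U6_modulus.
  set v := w ^+ j in F_neq0 *; set y := z ^+ t in F_neq0.
  have vN : v ^+ N = 1 by apply: omega_unity.
  have y3 : y ^+ 3 = 1 by rewrite exprAC (prim_expr_order z_prim) expr1n.
  have yV3 : y^-1 ^+ 3 = 1 by rewrite exprVn y3 invr1.
  have e1 := cayley_fourier vN y3 fE.
  have [y1|y_neq1] := eqVneq y 1.
    left; apply: (mulIf F_neq0); rewrite y1 in e1 *.
    by rewrite [LHS]e1 invr1 mulrDl.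
  (* The relations for [y] and [y^-1], applied in turn, multiply [F v y] by the product of the two
     odd sums. *)
  right; exists y; split=> //; apply: (mulIf F_neq0).
  have := cayley_fourier vN yV3 fE; rewrite invrK.
  move: e1; rewrite -/(F v y) -/(F v y^-1) => e1 e2.
  have d1 : (lambda - even_sum v) * F v y = odd_sum v y * F v y^-1.
    by rewrite mulrBl e1; ring.
  have d2 : (lambda - even_sum v) * F v y^-1 = odd_sum v y^-1 * F v y.
    by rewrite mulrBl e2; ring.
  by rewrite expr2 -mulrA d1 mulrCA d2 mulrA.
(* If all coefficients vanish, inversion over Z/3 and then over Z/2n gives [f = 0]. *)
case/eqP: fg_neq0; case: g => i e.
apply: (@fourier_injective _ (fun e => f (i, e)) (fun e : 'Z_3 => z ^+ e) 3) => //.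
- by move=> d; rewrite exprAC (prim_expr_order z_prim) expr1n.
- move=> d d' /eqP; rewrite (eq_prim_root_expr z_prim) !modn_small //.
  by move=> /eqP/val_inj.
move=> t; pose a (k : 'Z_(n.*2)) := \sum_(d : 'Z_3) f (k, d) * (z ^+ d) ^+ t.
apply: (@fourier_injective _ a (fun k : 'Z_(n.*2) => w ^+ k) N) => //.
- by move=> d; rewrite exprAC U6_modulus wN expr1n.
- have ltN (d : 'Z_(n.*2)) : (d < n.*2)%N by rewrite -[X in (_ < X)%N]U6_modulus.
  move=> d d' /eqP; rewrite (eq_prim_root_expr w_prim) !modn_small //.
  by move=> /eqP/val_inj.
move=> j; have /negbFE/eqP Fjt := F0 (j, t); rewrite -[RHS]Fjt.
rewrite /F /=; transitivity (\sum_k \sum_d f (k, d) * U6char (w ^+ j) (z ^+ t) (k, d)).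
  apply: eq_bigr => k _; rewrite mulr_suml; apply: eq_bigr => d _.
  by rewrite /U6char /= (exprAC w) (exprAC z) mulrAC mulrA.
by rewrite pair_bigA; apply: eq_bigr => -[k d].
Qed.

End CayleySet.
End U6n.

(** * The subgroup generated by a^2 *)

Section U6subgroup.
Variable n : nat.
Hypothesis n_gt0 : (0 < n)%N.

Lemma U6a_expn i : (U6a n ^+ i)%g = (i%:R, 0) :> U6 n.
Proof.
elim: i => [|i IH]; first by rewrite expg0.
rewrite expgS IH; transitivity ((1 + i%:R, @U6sgn n i%:R * 0 + 0) : U6 n) => //.
by rewrite mulr0 addr0 nat1r.
Qed.

Lemma val_natr_ZN i : val (i%:R : 'Z_(n.*2)) = (i %% n.*2)%N.
Proof. by apply: val_Zp_nat; case: (n) n_gt0. Qed.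

Lemma order_U6a_sqr : #[U6a n ^+ 2]%g = n.
Proof.
have dvdE i : (#[U6a n ^+ 2]%g %| i)%N = (n %| i)%N.
  rewrite order_dvdn -expgM U6a_expn -(@dvdn_pmul2l 2 n) // !mul2n.
  rewrite xpair_eqE eqxx andbT -val_eqE val_natr_ZN.
  by rewrite /dvdn.
by apply/eqP; rewrite eqn_dvd dvdE dvdnn -dvdE dvdnn.
Qed.

Lemma mem_cycle_U6a_sqr s : s \in <[U6a n ^+ 2]>%g -> ~~ odd (val s.1) /\ s.2 = 0.
Proof.
case/cycleP=> i ->; rewrite -expgM U6a_expn; split=> //=.
by rewrite val_natr_ZN odd_mod ?odd_double // mul2n odd_double.
Qed.

End U6subgroup.

(** * The integrality criterion *)

Section IntegralityCriterion.
Variables (n : nat) (S1 S2 : {set U6 n}).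
Hypotheses (n_gt0 : (0 < n)%N) (S1_sub : S1 \subset <[U6a n ^+ 2]>%g)
  (S2_odd : forall s, s \in S2 -> odd (val s.1))
  (SV : ((S1 :|: S2)^-1 = S1 :|: S2)%g).

Lemma integral_cayley_U6P :
  integral_cayley (S1 :|: S2) <->
  [/\ in_boolalg <[U6a n ^+ 2]>%g S1,
      (forall j : nat, (j <= 2 * n - 1)%N -> cset (chi j) S2 \is a Num.int)
    & (forall k : nat, (k <= n - 1)%N ->
         exists m : int, 2 * cset2 (psi k) S2 = (m ^+ 2)%:~R)].
Proof.
have S1_even s : s \in S1 -> ~~ odd (val s.1) /\ s.2 = 0.
  by move=> /(subsetP S1_sub); apply: mem_cycle_U6a_sqr.
have [z z_prim] := @C_prim_root_exists 3 isT.
have z3 := prim_expr_order z_prim.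
have z_neq1 : z != 1 by rewrite -(prim_order_dvd z_prim 1).
have chi_sum j : cset (chi j) S2 = odd_sum S2 (omega n ^+ j) 1.
  by apply: eq_bigr => s _; rewrite chiE.
have even_Aint j : even_sum S1 (omega n ^+ j) \in Aint.
  apply: (@Aint_sum_unity _ _ _ (Zp_trunc n.*2).+2) => // s.
  by rewrite -exprAC omega_unity // expr1n.
have odd_Aint j y : (y ^+ 3 = 1) -> odd_sum S2 (omega n ^+ j) y \in Aint.
  move=> y3; apply: (@Aint_sum_unity _ _ _ ((Zp_trunc n.*2).+2 * 3)) => // s.
  by rewrite U6char_unity // omega_unity.
split=> [S_int | [S1_boolalg chi_int psi_sqr] lambda].
  have quad j t : (t ^+ 2 = odd_sum S2 (omega n ^+ j) z * odd_sum S2 (omega n ^+ j) z^-1) ->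
      (even_sum S1 (omega n ^+ j) + t \is a Num.int).
    move=> t2; apply: S_int.
    exact: (eigenvalue_quadratic S1_even S2_odd (omega_unity n_gt0 j) z3 z_neq1 t2).
  have even_sum_t j :
       (exists2 t, t \is a Num.int &
         t ^+ 2 = odd_sum S2 (omega n ^+ j) z * odd_sum S2 (omega n ^+ j) z^-1)
       /\ even_sum S1 (omega n ^+ j) \is a Num.int.
    set P := (_ * _); have t2 := sqrtCK P.
    have tN2 : ((- sqrtC P) ^+ 2 = P) by rewrite sqrrN.
    have Aint_j : even_sum S1 (omega n ^+ j) \is a Num.int.
      apply: Cint_rat_Aint => //.
      (* Half the sum of two integer eigenvalues is rational, and a sum of roots of unity is an
         algebraic integer. *)
      rewrite (_ : even_sum _ _ = ((even_sum S1 (omega n ^+ j) + sqrtC P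
                                  + (even_sum S1 (omega n ^+ j) - sqrtC P)) / 2)).
        by rewrite rpred_div ?rpred_nat // rpredD // rpred_int_num ?quad.
      by field.
    split=> //; exists (sqrtC P) => //.
    by rewrite -(addKr (even_sum S1 (omega n ^+ j)) (sqrtC P)) rpredD ?rpredN // quad.
  have even_int j := (even_sum_t j).2.
  split=> [|j _|k _].
  - have w2_prim : #[U6a n ^+ 2]%g.-primitive_root (omega n ^+ 2).
      rewrite order_U6a_sqr //; have := exp_prim_root (omega_prim n_gt0) 2.
      by rewrite -mul2n gcdnMr mulKn.
    have lE i : omega n ^+ val ((U6a n ^+ 2) ^+ i)%g.1 = (omega n ^+ 2) ^+ i.
      rewrite -expgM U6a_expn val_natr_ZN // expr_mod ?exprM //.
      exact: prim_expr_order (omega_prim n_gt0).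
    apply: (@boolalg_cycle_of_sum_int _ _ _ (fun x : U6 n => omega n ^+ val x.1)
              w2_prim lE) => // j.
    rewrite (eq_bigr (fun s : U6 n => (omega n ^+ j) ^+ val s.1)) ?even_int // => s _.
    by rewrite exprAC.
  - rewrite chi_sum -(addKr (even_sum S1 (omega n ^+ j)) (odd_sum _ _ _)) rpredD ?rpredN //.
    apply: S_int; exact: (eigenvalue_linear S1_even S2_odd (omega_unity n_gt0 j)).
  - have [[t /intrP[m ->] t2] _] := even_sum_t k.
    (* Twice [cset2 (psi k) S2] is four times the product of the odd sums, that is [4 * t ^+ 2] with
       [t = m]. *)
    exists (2 * m); rewrite (cset2_psi _ S2_odd _ z3) // -t2.
    by rewrite !rmorphXn /= rmorphM /=; ring.
case/(eigenvalue_cases n_gt0 S1_even S2_odd SV) => j j_lt.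
have even_int : even_sum S1 (omega n ^+ j) \is a Num.int.
  apply: (boolalg_sum_int _ S1_boolalg) => // x y _ _.
  by rewrite U6fstM expr_ordD // omega_unity.
case=> [->|[y [y3 y_neq1 yE]]].
  by rewrite rpredD // -chi_sum chi_int // mul2n -ltnS -subSn ?double_gt0 // subn1.
have j_mod : (j %% n <= n - 1)%N by rewrite subn1 -ltnS prednK // ltn_pmod.
have [m mE] := psi_sqr _ j_mod.
rewrite -(subrK (even_sum S1 (omega n ^+ j)) lambda) rpredD //.
apply: int_of_rat_sqr; last by rewrite yE rpredM ?odd_Aint // exprVn y3 invr1.
(* The doubled difference has square [m ^+ 2], so it is [m] or its opposite; the difference is thus
   rational, with an algebraic integer as its square. *)
have m2 : (2 * (lambda - even_sum S1 (omega n ^+ j))) ^+ 2 = m%:~R ^+ 2.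
  rewrite -rmorphXn /= -mE exprMn yE.
  rewrite (_ : cset2 _ _ = cset2 (psi j) S2).
    by rewrite (cset2_psi _ S2_odd _ y3) //; ring.
  by apply: eq_bigr => s _; apply: eq_bigr => t _; rewrite psi_mod.
have r_rat : 2 * (lambda - even_sum S1 (omega n ^+ j)) \in Crat.
  by move/eqP: m2; rewrite eqf_sqr => /orP[] /eqP ->; rewrite ?rpredN rpred_int.
have two_neq0 : (2 : algC) != 0 by rewrite pnatr_eq0.
by rewrite -(mulKf two_neq0 (lambda - _)) rpredM ?rpredV ?rpred_nat.
Qed.

End IntegralityCriterion.

Unset Implicit Arguments.
Local Close Scope ring_scope.
Local Open Scope group_scope.

Theorem theorem4p1 (n : nat) (S1 S2 : {set U6 n}) :
  (0 < n)%N ->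
  S1 \subset <[U6a n ^+ 2]> :\ 1 ->
  S2 \subset (<[U6a n ^+ 2]> :* U6a n)
           :|: (<[U6a n ^+ 2]> :* (U6a n * U6b n))
           :|: (<[U6a n ^+ 2]> :* (U6a n * U6b n ^+ 2)) ->
  1 \notin S1 :|: S2 ->
  (S1 :|: S2)^-1 = S1 :|: S2 ->
  integral_cayley (S1 :|: S2) <->
  [/\ in_boolalg <[U6a n ^+ 2]> S1,
      (forall j : nat, (j <= 2 * n - 1)%N -> cset (chi j) S2 \is a Num.int)
    & (forall k : nat, (k <= n - 1)%N ->
         exists m : int, (2 * cset2 (psi k) S2 = (m ^+ 2)%:~R)%R)].
Proof.
move=> n_gt0 sS1 sS2 _ SV.
have S1_sub : S1 \subset <[U6a n ^+ 2]> by apply: subset_trans sS1 (subsetDl _ _).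
apply: integral_cayley_U6P => // s.
(* The representatives a, ab and ab^2 all have odd a-exponent, and elements of [<[U6a n ^+ 2]>] have
   even a-exponent. *)
have coset_odd y : odd (val y.1) -> s \in <[U6a n ^+ 2]> :* y -> odd (val s.1).
  move=> y_odd /rcosetP[c /(mem_cycle_U6a_sqr n_gt0)[c_even _] ->].
  by rewrite U6fstM odd_ZpD (negPf c_even).
by move=> /(subsetP sS2); rewrite !in_setU => /orP[/orP[]|]; apply: coset_odd.
Qed.
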